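(* Let $k$ be a field, let $A$ be a Hopf algebra over $k$ and let $(H,\cdot,\circ)$ be a cocommutative Hopf brace over $k$, where $S$ denotes the antipode of $H=(H,\cdot)$. Let $\triangleright : H\otimes A\to A$, $\triangleleft : H\otimes A\to H$ and $\blacktriangleright : H\otimes A\to A$ be linear maps such that $(A,H,\triangleright,\triangleleft)$ is a matched pair of Hopf algebras (with $H=(H,\cdot)$) and $(A,\blacktriangleright)$ is a left $H_\circ$-module bialgebra. Assume that for all $a\in A$ and $x,x'\in H$ $$x\blacktriangleright(x'\triangleright a) = \big((x_{(1)}\circ x')\,S(x_{(2)})\big)\triangleright (x_{(3)}\blacktriangleright a),$$ $$x\circ(x'\triangleleft a) = \Big[\big((x_{(1)}\circ x')\,S(x_{(2)})\big)\triangleleft (x_{(3)}\blacktriangleright a)\Big]\,x_{(4)}.$$ Then the tensor product coalgebra $A\otimes H$ together with the two algebra structures $$(a\otimes x)(b\otimes y) = a(x_{(1)}\triangleright b_{(1)})\otimes (x_{(2)}\triangleleft b_{(2)})\,y,$$ $$(a\otimes x)\circ(b\otimes y) = a(x_{(1)}\blacktriangleright b)\otimes x_{(2)}\circ y$$ ($a,b\in A$, $x,y\in H$) is a Hopf brace.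
   Context: All vector spaces, tensor products, algebras, coalgebras and Hopf algebras are over the field $k$. Sweedler notation $\Delta(c)=c_{(1)}\otimes c_{(2)}$ is used with summation suppressed. Hopf brace: a Hopf brace over a coalgebra $(H,\Delta,\varepsilon)$ consists of two Hopf algebra structures $(H,\cdot,1,\Delta,\varepsilon,S)$ and $(H,\circ,1_\circ,\Delta,\varepsilon,T)$ on the same coalgebra such that for all $x,y,z\in H$ $$x\circ(yz) = (x_{(1)}\circ y)\,S(x_{(2)})\,(x_{(3)}\circ z),$$ where juxtaposition denotes the product $\cdot$ (it follows that $1=1_\circ$). One writes $(H,\cdot,\circ)$ for the Hopf brace, $H$ for the first Hopf algebra and $H_\circ$ for the second. A Hopf brace is cocommutative if its underlying coalgebra is cocommutative. In a pair of algebra structures on a coalgebra said to be a Hopf brace, the one written by juxtaposition plays the role of $\cdot$ and the other that of $\circ$. Matched pair: for Hopf algebras $A$, $H$, a matched pair consists of coalgebra maps $\triangleleft : H\otimes A\to H$ and $\triangleright : H\otimes A\to A$ such that $(A,\triangleright)$ is a left $H$-module coalgebra, $(H,\triangleleft)$ is a right $A$-module coalgebra, and for all $a,b\in A$, $x,y\in H$: $x\triangleright 1_A=\varepsilon_H(x)1_A$ and $1_H\triangleleft a=\varepsilon_A(a)1_H$; $x\triangleright(ab)=(x_{(1)}\triangleright a_{(1)})\big((x_{(2)}\triangleleft a_{(2)})\triangleright b\big)$; $(xy)\triangleleft a=\big(x\triangleleft(y_{(1)}\triangleright a_{(1)})\big)(y_{(2)}\triangleleft a_{(2)})$; $x_{(1)}\triangleleft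 a_{(1)}\otimes x_{(2)}\triangleright a_{(2)}=x_{(2)}\triangleleft a_{(2)}\otimes x_{(1)}\triangleright a_{(1)}$. Left $K$-module bialgebra (for a Hopf algebra $K$): a bialgebra $A$ with a left $K$-module structure making it both a left module algebra ($x\cdot(ab)=(x_{(1)}\cdot a)(x_{(2)}\cdot b)$, $x\cdot 1=\varepsilon(x)1$) and a left module coalgebra (the action map $K\otimes A\to A$ is a coalgebra map). *)

(* Defs.v *)
From HB Require Import structures.
From mathcomp Require Import all_boot all_algebra finmap.
From mathcomp Require Import boolp.
From mathcomp Require Import monalg.

Set Implicit Arguments.
Unset Strict Implicit.
Unset Printing Implicit Defensive.

Import GRing.Theory.
Local Open Scope ring_scope.

Reserved Notation "U ⊗ V" (at level 40, left associativity).
Reserved Notation "\tsum_ ( u ⊗ v <- t ) E"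
  (at level 41, u name, v name, t at level 60, E at level 41,
   format "\tsum_ ( u  ⊗  v  <-  t )  E").
Reserved Notation "\sw_ ( x1 , x2 <- x ) E"
  (at level 41, x1 name, x2 name, x at level 60, E at level 41,
   format "\sw_ ( x1 ,  x2  <-  x )  E").
Reserved Notation "\sw_ ( x1 , x2 , x3 <- x ) E"
  (at level 41, x1 name, x2 name, x3 name, x at level 60, E at level 41,
   format "\sw_ ( x1 ,  x2 ,  x3  <-  x )  E").
Reserved Notation "\sw_ ( x1 , x2 , x3 , x4 <- x ) E"
  (at level 41, x1 name, x2 name, x3 name, x4 name, x at level 60,
   E at level 41, format "\sw_ ( x1 ,  x2 ,  x3 ,  x4  <-  x )  E").
Reserved Notation "x ·[ A ] y"
  (at level 40, left associativity, format "x  ·[ A ]  y").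

Section TensorProduct.
Variables (k : fieldType) (U V : lmodType k).

Local Notation free := {malg k[(U * V)%type]}.
Local Notation gen u v := (@mkmalgU (U * V)%type k (u, v) 1).

Inductive tens_null : free -> Prop :=
| tens_null0 : tens_null 0
| tens_nullD x y : tens_null x -> tens_null y -> tens_null (x + y)
| tens_nullZ a x : tens_null x -> tens_null (a *: x)
| tens_nullDl u u' v : tens_null (gen (u + u') v - gen u v - gen u' v)
| tens_nullDr u v v' : tens_null (gen u (v + v') - gen u v - gen u v')
| tens_nullZl a u v : tens_null (gen (a *: u) v - a *: gen u v)
| tens_nullZr a u v : tens_null (gen u (a *: v) - a *: gen u v).

Definition tens_null_pred : {pred free} := fun x => `[< tens_null x >].

Lemma tens_null_zmod_closed : zmod_closed tens_null_pred.
Proof.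
split=> [|x y /asboolP xn /asboolP yn]; first by apply/asboolP; exact: tens_null0.
apply/asboolP/tens_nullD => //; rewrite -scaleN1r; exact: tens_nullZ.
Qed.

HB.instance Definition _ :=
  GRing.isZmodClosed.Build free tens_null_pred tens_null_zmod_closed.

Definition tensor : Type := @Quotient.quot free tens_null_pred.

HB.instance Definition _ := GRing.Zmodule.on tensor.

Definition tens_class (x : free) : tensor :=
  \pi_(@Quotient.quot free tens_null_pred)%qT x.
Local Notation cls := tens_class.

Lemma cls_eq (x y : free) : cls x = cls y <-> tens_null (x - y).
Proof.
have E := Quotient.idealrBE tens_null_pred x y.
split=> [/eqP|xy]; first by rewrite -E => /asboolP.
by apply/eqP; rewrite -E; apply/asboolP.
Qed.

Lemma clsD x y : cls (x + y) = cls x + cls y.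
Proof. by rewrite /tens_class raddfD. Qed.

Lemma cls0 : cls 0 = 0.
Proof. by rewrite /tens_class raddf0. Qed.

Definition tens_scale (a : k) (t : tensor) : tensor := cls (a *: repr t).

Lemma cls_repr (t : tensor) : cls (repr t) = t.
Proof. exact: reprK. Qed.

Lemma clsZ a x : cls (a *: x) = tens_scale a (cls x).
Proof.
apply/cls_eq; rewrite -scalerBr; apply: tens_nullZ; apply/cls_eq.
by rewrite cls_repr.
Qed.

Lemma tens_scaleA a b t : tens_scale a (tens_scale b t) = tens_scale (a * b) t.
Proof. by rewrite -[t]cls_repr -!clsZ scalerA. Qed.
Lemma tens_scale1 : left_id 1 tens_scale.
Proof. by move=> t; rewrite -[t]cls_repr -!clsZ scale1r. Qed.
Lemma tens_scaleDr : right_distributive tens_scale +%R.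
Proof.
by move=> a s t; rewrite -[s]cls_repr -[t]cls_repr -!clsZ -!clsD -clsZ scalerDr.
Qed.
Lemma tens_scaleDl t : {morph tens_scale^~ t : a b / a + b}.
Proof. by move=> a b; rewrite -[t]cls_repr -!clsZ -clsD scalerDl. Qed.

HB.instance Definition _ := GRing.Zmodule_isLmodule.Build k tensor
  tens_scaleA tens_scale1 tens_scaleDr tens_scaleDl.

Definition free_sum (W : lmodType k) (f : U -> V -> W) (x : free) : W :=
  \sum_(p <- msupp x) mcoeff p x *: f p.1 p.2.

End TensorProduct.

HB.lock Definition tens (k : fieldType) (U V : lmodType k) (u : U) (v : V)
  : tensor U V := tens_class (mkmalgU (u, v) 1).

(* [tsum f t] is [\sum_i f u_i v_i] for a chosen expression
    [t = \sum_i u_i ⊗ v_i]; it does not depend on that choice if [f] is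
    bilinear: see [tsum_tens] and [tsum_linear]. *)
HB.lock Definition tsum (k : fieldType) (U V W : lmodType k)
  (f : U -> V -> W) (t : tensor U V) : W := free_sum f (repr t).

Arguments tensor {k} U%_type V%_type.
Notation "U ⊗ V" := (tensor U V) : type_scope.
Notation "u ⊗ v" := (tens u v) : ring_scope.
Notation "\tsum_ ( u ⊗ v <- t ) E" := (tsum (fun u v => E) t) : ring_scope.

Section TensorTheory.
Variables (k : fieldType) (U V : lmodType k).
Local Notation free := {malg k[(U * V)%type]}.

Lemma tens_bilinear : bilinear_for *:%R *:%R (@tens k U V).
Proof.
have addl u u' v : (u + u') ⊗ v = u ⊗ v + u' ⊗ v :> tensor U V.
  by rewrite tens.unlock -clsD; apply/cls_eq; rewrite opprD addrA; exact: tens_nullDl.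
have addr u v v' : u ⊗ (v + v') = u ⊗ v + u ⊗ v' :> tensor U V.
  by rewrite tens.unlock -clsD; apply/cls_eq; rewrite opprD addrA; exact: tens_nullDr.
have scl a u v : (a *: u) ⊗ v = a *: (u ⊗ v) :> tensor U V.
  by rewrite tens.unlock /GRing.scale/= -clsZ; apply/cls_eq; exact: tens_nullZl.
have scr a u v : u ⊗ (a *: v) = a *: (u ⊗ v) :> tensor U V.
  by rewrite tens.unlock /GRing.scale/= -clsZ; apply/cls_eq; exact: tens_nullZr.
by split=> [v a u u'|u a v v'] /=; rewrite ?addl ?scl ?addr ?scr.
Qed.

Lemma tensDl u u' (v : V) : (u + u') ⊗ v = u ⊗ v + u' ⊗ v :> U ⊗ V.
Proof. by have /= := tens_bilinear.1 v 1 u u'; rewrite !scale1r. Qed.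
Lemma tensDr (u : U) v v' : u ⊗ (v + v') = u ⊗ v + u ⊗ v' :> U ⊗ V.
Proof. by have /= := tens_bilinear.2 u 1 v v'; rewrite !scale1r. Qed.
Lemma tens0l (v : V) : 0 ⊗ v = 0 :> U ⊗ V.
Proof. by apply: (addrI (0 ⊗ v)); rewrite -tensDl !addr0. Qed.
Lemma tens0r (u : U) : u ⊗ 0 = 0 :> U ⊗ V.
Proof. by apply: (addrI (u ⊗ 0)); rewrite -tensDr !addr0. Qed.
Lemma tensZl a u (v : V) : (a *: u) ⊗ v = a *: (u ⊗ v) :> U ⊗ V.
Proof. by have /= := tens_bilinear.1 v a u 0; rewrite tens0l !addr0. Qed.
Lemma tensZr a (u : U) v : u ⊗ (a *: v) = a *: (u ⊗ v) :> U ⊗ V.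
Proof. by have /= := tens_bilinear.2 u a v 0; rewrite tens0r !addr0. Qed.

Section Sum.
Variables (W : lmodType k) (f : U -> V -> W).

Lemma free_sumEw (d : {fset (U * V)%type}) (x : free) : (msupp x `<=` d)%fset ->
  free_sum f x = \sum_(p <- d) mcoeff p x *: f p.1 p.2.
Proof.
move=> le; rewrite /free_sum (big_fset_incl _ le) // => p _ /mcoeff_outdom ->.
by rewrite scale0r.
Qed.

Lemma free_sumD x y : free_sum f (x + y) = free_sum f x + free_sum f y.
Proof.
pose d := (msupp x `|` msupp y)%fset.
rewrite !(@free_sumEw d) ?fsubsetUl ?fsubsetUr ?msuppD_le //.
by rewrite -big_split; apply: eq_bigr => p _; rewrite mcoeffD scalerDl.
Qed.

Lemma free_sumZ a x : free_sum f (a *: x) = a *: free_sum f x.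
Proof.
rewrite (free_sumEw (msuppZ_le a x)) /free_sum scaler_sumr.
by apply: eq_bigr => p _; rewrite mcoeffZ scalerA.
Qed.

Lemma free_sum_gen u v : free_sum f (mkmalgU (u, v) 1) = f u v.
Proof.
by rewrite (free_sumEw msuppU_le) big_seq_fset1 mcoeffUU scale1r.
Qed.

Hypothesis fbil : bilinear_for *:%R *:%R f.

Lemma free_sum_null x : tens_null x -> free_sum f x = 0.
Proof.
have sumB y z : free_sum f (y - z) = free_sum f y - free_sum f z.
  by rewrite -(scaleN1r z) free_sumD free_sumZ scaleN1r.
have addl u u' v : f (u + u') v = f u v + f u' v.
  by have /= := fbil.1 v 1 u u'; rewrite !scale1r.
have addr u v v' : f u (v + v') = f u v + f u v'.
  by have /= := fbil.2 u 1 v v'; rewrite !scale1r.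
have f0l v : f 0 v = 0.
  by apply: (addrI (f 0 v)); rewrite -addl !addr0.
have f0r u : f u 0 = 0.
  by apply: (addrI (f u 0)); rewrite -addr !addr0.
have scl a u v : f (a *: u) v = a *: f u v.
  by have /= := fbil.1 v a u 0; rewrite /= f0l !addr0.
have scr a u v : f u (a *: v) = a *: f u v.
  by have /= := fbil.2 u a v 0; rewrite /= f0r !addr0.
elim=> {x}.
- by rewrite -(scale0r (0 : free)) free_sumZ scale0r.
- by move=> x y _ IHx _ IHy; rewrite free_sumD IHx IHy addr0.
- by move=> a x _ IHx; rewrite free_sumZ IHx scaler0.
- by move=> u u' v; rewrite !sumB !free_sum_gen addl addrAC addrK subrr.
- by move=> u v v'; rewrite !sumB !free_sum_gen addr addrAC addrK subrr.
- by move=> a u v; rewrite !sumB free_sumZ !free_sum_gen scl subrr.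
- by move=> a u v; rewrite !sumB free_sumZ !free_sum_gen scr subrr.
Qed.

Lemma free_sum_cls (x y : free) : tens_null (x - y) ->
  free_sum f x = free_sum f y.
Proof.
by move=> /free_sum_null xy0; rewrite -[x](subrK y) free_sumD xy0 add0r.
Qed.

Lemma tsum_tens u v : tsum f (u ⊗ v) = f u v.
Proof.
by rewrite tsum.unlock tens.unlock -[RHS]free_sum_gen; apply/free_sum_cls/cls_eq; rewrite cls_repr.
Qed.

Lemma tsum_linear : linear (tsum f).
Proof.
move=> a s t; rewrite tsum.unlock -free_sumZ -free_sumD; apply/free_sum_cls/cls_eq.
by rewrite clsD clsZ !cls_repr.
Qed.

End Sum.

Lemma tens_ind (P : U ⊗ V -> Prop) :
  (forall u v, P (u ⊗ v)) -> (forall s t, P s -> P t -> P (s + t)) ->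
  forall t, P t.
Proof.
move=> Pp PD t; rewrite -[t]cls_repr [repr t]monalgE.
elim/big_ind: _ => [|x y Px Py|[u v] _].
- by rewrite cls0 -(tens0l 0).
- by rewrite clsD; exact: PD.
have -> : mkmalgU (u, v) (mcoeff (u, v) (repr t)) =
          mcoeff (u, v) (repr t) *: (mkmalgU (u, v) 1 : free).
  by apply/malgP => q; rewrite mcoeffZ !mcoeffU mulrnAr mulr1.
by have := Pp (mcoeff (u, v) (repr t) *: u) v; rewrite tensZl clsZ tens.unlock.
Qed.

Lemma linear_tens_ext (W : lmodType k) (f g : U ⊗ V -> W) :
  linear f -> linear g -> (forall u v, f (u ⊗ v) = g (u ⊗ v)) -> f =1 g.
Proof.
move=> fl gl fg; elim/tens_ind=> [|s t fs ft]; first exact: fg.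
by have := fl 1 s t; have := gl 1 s t; rewrite !scale1r fs ft => -> ->.
Qed.

End TensorTheory.

HB.mixin Record isCoalgebra (k : fieldType) C of GRing.Lmodule k C := {
  comul : {linear C -> (C ⊗ C)%type};
  counit : {scalar C};
  comulA : forall c : C,
    \tsum_(c1 ⊗ c2 <- comul c) \tsum_(c11 ⊗ c12 <- comul c1) c11 ⊗ (c12 ⊗ c2)
    = \tsum_(c1 ⊗ c2 <- comul c) c1 ⊗ comul c2;
  counitl : forall c : C, \tsum_(c1 ⊗ c2 <- comul c) counit c1 *: c2 = c;
  counitr : forall c : C, \tsum_(c1 ⊗ c2 <- comul c) counit c2 *: c1 = c
}.

#[short(type="coalgType")]
HB.structure Definition Coalgebra (k : fieldType) :=
  {C of GRing.Lmodule k C & isCoalgebra k C}.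

(* Sweedler notation; by coassociativity the bracketing is immaterial. *)
Notation "\sw_ ( x1 , x2 <- x ) E" := (\tsum_(x1 ⊗ x2 <- comul x) E)
  : ring_scope.
Definition sweedler3 (k : fieldType) (C : coalgType k) (W : lmodType k)
    (f : C -> C -> C -> W) (x : C) : W :=
  \sw_(x1, y <- x) \sw_(x2, x3 <- y) f x1 x2 x3.
Definition sweedler4 (k : fieldType) (C : coalgType k) (W : lmodType k)
    (f : C -> C -> C -> C -> W) (x : C) : W :=
  \sw_(x1, y <- x) \sw_(x2, z <- y) \sw_(x3, x4 <- z) f x1 x2 x3 x4.
Notation "\sw_ ( x1 , x2 , x3 <- x ) E" :=
  (sweedler3 (fun x1 x2 x3 => E) x) : ring_scope.
Notation "\sw_ ( x1 , x2 , x3 , x4 <- x ) E" :=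
  (sweedler4 (fun x1 x2 x3 x4 => E) x) : ring_scope.

Section SumTheory.
Variable k : fieldType.
Implicit Types U V W : lmodType k.

Lemma linear_id U : linear (fun u : U => u).
Proof. by []. Qed.

Lemma tens_linearl U V W (g : W -> U) (v : V) :
  linear g -> linear (fun w => g w ⊗ v).
Proof. by move=> gl a w w'; rewrite gl; exact: (@tens_bilinear k U V).1. Qed.

Lemma tens_linearr U V W (u : U) (g : W -> V) :
  linear g -> linear (fun w => u ⊗ g w).
Proof. by move=> gl a w w'; rewrite gl; exact: (@tens_bilinear k U V).2. Qed.

Lemma tsum_linear_comp U V W W' (f : U -> V -> W) (g : W' -> U ⊗ V) :
  bilinear_for *:%R *:%R f -> linear g -> linear (fun w => tsum f (g w)).
Proof. by move=> fb gl a w w'; rewrite gl; exact: tsum_linear. Qed.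

Lemma tsum_linear_param U V W W' (F : W -> U -> V -> W') (t : U ⊗ V) :
  (forall u v, linear (fun w => F w u v)) -> linear (fun w => tsum (F w) t).
Proof.
move=> Fl a w w'; rewrite tsum.unlock /free_sum scaler_sumr -big_split.
by apply: eq_bigr => p _; rewrite Fl scalerDr !scalerA mulrC.
Qed.

Lemma eq_tsum U V W (f g : U -> V -> W) (t : U ⊗ V) :
  (forall u v, f u v = g u v) -> tsum f t = tsum g t.
Proof. by move=> fg; rewrite tsum.unlock; apply: eq_bigr => p _; rewrite fg. Qed.

Lemma linear_tsum U V W W' (L : W -> W') (f : U -> V -> W) (t : U ⊗ V) :
  linear L -> L (tsum f t) = \tsum_(u ⊗ v <- t) L (f u v).
Proof.
move=> Ll.
have L0 : L 0 = 0 by have := Ll (-1) 0 0; rewrite scaler0 addr0 scaleN1r addNr.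
have LD x y : L (x + y) = L x + L y by have := Ll 1 x y; rewrite !scale1r.
have LZ a x : L (a *: x) = a *: L x by have := Ll a x 0; rewrite L0 !addr0.
rewrite tsum.unlock /free_sum; elim/big_rec2: _ => // p y x _ <-.
by rewrite LD LZ.
Qed.

Lemma tens_tsuml U V U' V' (f : U' -> V' -> U) (t : U' ⊗ V') (v : V) :
  tsum f t ⊗ v = \tsum_(x ⊗ y <- t) f x y ⊗ v.
Proof. by apply: (linear_tsum _ _ (tens_linearl v (@linear_id U))). Qed.

Lemma tens_tsumr U V U' V' (f : U' -> V' -> V) (t : U' ⊗ V') (u : U) :
  u ⊗ tsum f t = \tsum_(x ⊗ y <- t) u ⊗ f x y.
Proof. by apply: (linear_tsum _ _ (tens_linearr u (@linear_id V))). Qed.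

Lemma exchange_tsum U V U' V' W (F : U -> V -> U' -> V' -> W)
    (s : U ⊗ V) (t : U' ⊗ V') :
  \tsum_(u ⊗ v <- s) \tsum_(u' ⊗ v' <- t) F u v u' v' =
  \tsum_(u' ⊗ v' <- t) \tsum_(u ⊗ v <- s) F u v u' v'.
Proof.
rewrite tsum.unlock /free_sum; under eq_bigr do rewrite scaler_sumr.
rewrite exchange_big /=; apply: eq_bigr => p _; rewrite scaler_sumr.
by apply: eq_bigr => q _; rewrite !scalerA mulrC.
Qed.

Lemma tsum_tsum U V U' V' W (g : U -> V -> W) (F : U' -> V' -> U ⊗ V)
    (t : U' ⊗ V') : bilinear_for *:%R *:%R g ->
  tsum g (tsum F t) = \tsum_(u ⊗ v <- t) tsum g (F u v).
Proof. by move=> gb; apply: linear_tsum; exact: tsum_linear. Qed.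

Lemma sweedlerA (C : coalgType k) W (K : C -> C -> C -> W) (c : C) :
  (forall y z, linear (fun x => K x y z)) ->
  (forall x z, linear (fun y => K x y z)) ->
  (forall x y, linear (K x y)) ->
  \sw_(c1, c2 <- c) \sw_(c11, c12 <- c1) K c11 c12 c2 =
  \sw_(c1, c2 <- c) \sw_(c21, c22 <- c2) K c1 c21 c22.
Proof.
move=> K1 K2 K3.
pose L2 x (w : C ⊗ C) := \tsum_(y ⊗ z <- w) K x y z.
have L2b : bilinear_for *:%R *:%R L2.
  split=> [w|x]; first by apply: tsum_linear_param => y z; exact: K1.
  by apply: tsum_linear; split=> [z|y]; [exact: K2|exact: K3].
have Ll : linear (tsum L2) by exact: tsum_linear.
have /(congr1 (tsum L2)) := comulA c.
rewrite !tsum_tsum //.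
under eq_tsum => c1 c2.
  rewrite tsum_tsum //.
  under eq_tsum => c11 c12.
    rewrite tsum_tens // /L2 tsum_tens; last by split.
  over.
over.
move=> ->; apply: eq_tsum => c1 c2; exact: tsum_tens.
Qed.

End SumTheory.

Section TensorCoalgebra.
Variables (k : fieldType) (C D : coalgType k).

Lemma tensZZ (U V : lmodType k) a b (u : U) (v : V) :
  (a *: u) ⊗ (b *: v) = (a * b) *: (u ⊗ v).
Proof. by rewrite tensZl tensZr scalerA. Qed.

Definition tens_comul (t : C ⊗ D) : (C ⊗ D) ⊗ (C ⊗ D) :=
  \tsum_(c ⊗ d <- t) \sw_(c1, c2 <- c) \sw_(d1, d2 <- d) (c1 ⊗ d1) ⊗ (c2 ⊗ d2).

Definition tens_counit (t : C ⊗ D) : k :=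
  @tsum k C D k^o (fun c d => counit c * counit d) t.

Lemma sweedler2_linear (E : coalgType k) (W : lmodType k) (f : E -> E -> W) :
  bilinear_for *:%R *:%R f -> linear (fun x => \sw_(x1, x2 <- x) f x1 x2).
Proof.
by move=> fb; apply: tsum_linear_comp => //; exact: linearP.
Qed.

Lemma tens_comul_bilin : bilinear_for *:%R *:%R (fun (c : C) (d : D) =>
  \sw_(c1, c2 <- c) \sw_(d1, d2 <- d) (c1 ⊗ d1) ⊗ (c2 ⊗ d2)).
Proof.
split=> [d|c].
- apply: sweedler2_linear; split=> [c2|c1]; apply: tsum_linear_param => d1 d2.
  + by do 2!apply: tens_linearl.
  + by apply: tens_linearr; apply: tens_linearl.
- apply: tsum_linear_param => c1 c2; apply: sweedler2_linear.
  split=> [d2|d1].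
  + by apply: tens_linearl; apply: tens_linearr.
  + by do 2!apply: tens_linearr.
Qed.

Lemma tens_counit_bilin : bilinear_for *:%R *:%R
  ((fun c d => counit c * counit d) : C -> D -> k^o).
Proof.
split=> [d|c] a x y /=; rewrite linearP /= /GRing.scale /=.
  by rewrite mulrDl mulrA.
by rewrite mulrDr !mulrA [_ * a]mulrC.
Qed.

Lemma tens_comul_linear : linear tens_comul.
Proof. exact: tsum_linear tens_comul_bilin. Qed.

Lemma tens_counit_linear : scalar tens_counit.
Proof. exact: (tsum_linear tens_counit_bilin). Qed.

HB.instance Definition _ := GRing.isLinear.Build k (tensor C D) _ _
  tens_comul tens_comul_linear.
HB.instance Definition _ := GRing.isLinear.Build k (tensor C D) k *%R
  tens_counit tens_counit_linear.

Lemma tens_comulE c d : tens_comul (c ⊗ d) =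
  \sw_(c1, c2 <- c) \sw_(d1, d2 <- d) (c1 ⊗ d1) ⊗ (c2 ⊗ d2).
Proof. exact: tsum_tens tens_comul_bilin _ _. Qed.

Lemma tens_counitE c d : tens_counit (c ⊗ d) = counit c * counit d.
Proof. exact: tsum_tens tens_counit_bilin _ _. Qed.

Lemma tsum_tens_comul (W : lmodType k) (g : C ⊗ D -> C ⊗ D -> W) c d :
  bilinear_for *:%R *:%R g ->
  tsum g (tens_comul (c ⊗ d)) =
  \sw_(c1, c2 <- c) \sw_(d1, d2 <- d) g (c1 ⊗ d1) (c2 ⊗ d2).
Proof.
move=> gb; rewrite tens_comulE tsum_tsum //; apply: eq_tsum => c1 c2.
by rewrite tsum_tsum //; apply: eq_tsum => d1 d2; exact: tsum_tens.
Qed.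

Lemma tens_comulA (t : C ⊗ D) :
  \tsum_(t1 ⊗ t2 <- tens_comul t) \tsum_(t11 ⊗ t12 <- tens_comul t1)
    t11 ⊗ (t12 ⊗ t2)
  = \tsum_(t1 ⊗ t2 <- tens_comul t) t1 ⊗ tens_comul t2.
Proof.
have inb t2 : bilinear_for *:%R *:%R
    (fun t11 t12 : C ⊗ D => t11 ⊗ (t12 ⊗ t2)).
  split=> [t12|t11]; first exact: tens_linearl.
  by apply: tens_linearr; apply: tens_linearl.
have lb : bilinear_for *:%R *:%R (fun t1 t2 : C ⊗ D =>
    \tsum_(t11 ⊗ t12 <- tens_comul t1) t11 ⊗ (t12 ⊗ t2)).
  split=> [t2|t1].
    by apply: tsum_linear_comp => //; exact: tens_comul_linear.
  apply: tsum_linear_param => t11 t12.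
  by do 2!apply: tens_linearr.
have rb : bilinear_for *:%R *:%R (fun t1 t2 : C ⊗ D => t1 ⊗ tens_comul t2).
  split=> [t2|t1]; first exact: tens_linearl.
  by apply: tens_linearr; exact: tens_comul_linear.
move: t; apply: linear_tens_ext.
- by apply: tsum_linear_comp => //; exact: tens_comul_linear.
- by apply: tsum_linear_comp => //; exact: tens_comul_linear.
move=> c d; rewrite (tsum_tens_comul c d lb) (tsum_tens_comul c d rb).
pose K (x y z : C) (u v w : D) := (x ⊗ u) ⊗ ((y ⊗ v) ⊗ (z ⊗ w)).
have K1 y z u v w : linear (fun x => K x y z u v w).
  by do 2!apply: tens_linearl.
have K2 x z u v w : linear (fun y => K x y z u v w).
  by apply: tens_linearr; do 2!apply: tens_linearl.
have K3 x y u v w : linear (fun z => K x y z u v w).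
  by do 2!apply: tens_linearr; apply: tens_linearl.
have K4 x y z v w : linear (fun u => K x y z u v w).
  by apply: tens_linearl; apply: tens_linearr.
have K5 x y z u w : linear (fun v => K x y z u v w).
  by apply: tens_linearr; apply: tens_linearl; apply: tens_linearr.
have K6 x y z u v : linear (fun w => K x y z u v w).
  by do 3!apply: tens_linearr.
transitivity (\sw_(c1, c2 <- c) \sw_(c11, c12 <- c1)
  \sw_(d1, d2 <- d) \sw_(d11, d12 <- d1) K c11 c12 c2 d11 d12 d2).
  apply: eq_tsum => c1 c2; rewrite exchange_tsum; apply: eq_tsum => d1 d2.
  by rewrite tsum_tens_comul.
transitivity (\sw_(c1, c2 <- c) \sw_(c11, c12 <- c1)
  \sw_(d1, d2 <- d) \sw_(d21, d22 <- d2) K c11 c12 c2 d1 d21 d22).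
  by do 2!apply: eq_tsum => ? ?; exact: sweedlerA.
rewrite (@sweedlerA k C _ (fun c1 c2 c3 =>
    \sw_(d1, d2 <- d) \sw_(d21, d22 <- d2) K c1 c2 c3 d1 d21 d22));
  try by move=> ? ?; do 2!apply: tsum_linear_param => ? ?.
apply: eq_tsum => c1 c2; rewrite exchange_tsum; apply: eq_tsum => d1 d2.
rewrite tens_comulE tens_tsumr.
by apply: eq_tsum => c21 c22; rewrite tens_tsumr.
Qed.

Lemma tens_counitl (t : C ⊗ D) :
  \tsum_(t1 ⊗ t2 <- tens_comul t) tens_counit t1 *: t2 = t.
Proof.
have gb : bilinear_for *:%R *:%R (fun t1 t2 : C ⊗ D => tens_counit t1 *: t2).
  split=> [t2|t1] a x y /=; first by rewrite linearP scalerDl scalerA.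
  by rewrite scalerDr !scalerA mulrC.
move: t; apply: linear_tens_ext => //.
  by apply: tsum_linear_comp => //; exact: tens_comul_linear.
move=> c d; rewrite tsum_tens_comul //.
rewrite -[in RHS](counitl c) tens_tsuml.
apply: eq_tsum => c1 c2.
rewrite -[in RHS](counitl d) tens_tsumr.
by apply: eq_tsum => d1 d2; rewrite tens_counitE tensZZ.
Qed.

Lemma tens_counitr (t : C ⊗ D) :
  \tsum_(t1 ⊗ t2 <- tens_comul t) tens_counit t2 *: t1 = t.
Proof.
have gb : bilinear_for *:%R *:%R (fun t1 t2 : C ⊗ D => tens_counit t2 *: t1).
  split=> [t2|t1] a x y /=; last by rewrite linearP scalerDl scalerA.
  by rewrite scalerDr !scalerA mulrC.
move: t; apply: linear_tens_ext => //.
  by apply: tsum_linear_comp => //; exact: tens_comul_linear.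
move=> c d; rewrite tsum_tens_comul //.
rewrite -[in RHS](counitr c) tens_tsuml.
apply: eq_tsum => c1 c2.
rewrite -[in RHS](counitr d) tens_tsumr.
by apply: eq_tsum => d1 d2; rewrite tens_counitE tensZZ.
Qed.

HB.instance Definition _ := isCoalgebra.Build k (tensor C D)
  tens_comulA tens_counitl tens_counitr.

End TensorCoalgebra.

Definition coalgebra_map (k : fieldType) (C D : coalgType k)
    (f : {linear C -> D}) : Prop :=
  (forall c, comul (f c) = \sw_(c1, c2 <- c) f c1 ⊗ f c2) /\
  (forall c, counit (f c) = counit c).

Definition cocommutative (k : fieldType) (C : coalgType k) : Prop :=
  forall c : C, comul c = \sw_(c1, c2 <- c) c2 ⊗ c1.

(* The (bi)algebra structures are not attached to the type: a Hopf brace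
   carries two of them on one coalgebra. *)
Record bialgebra (k : fieldType) (B : coalgType k) := Bialgebra {
  mul : {linear (B ⊗ B)%type -> B};
  one : B;
  bialg_mulA : forall x y z,
    mul (mul (x ⊗ y) ⊗ z) = mul (x ⊗ mul (y ⊗ z));
  bialg_mul1l : forall x, mul (one ⊗ x) = x;
  bialg_mul1r : forall x, mul (x ⊗ one) = x;
  bialg_mul_coalgebra_map : coalgebra_map mul;
  bialg_comul1 : comul one = one ⊗ one;
  bialg_counit1 : counit one = 1
}.

Notation "x ·[ A ] y" := (mul A (x ⊗ y)) : ring_scope.

Record hopf_algebra (k : fieldType) (H : coalgType k) := HopfAlgebra {
  hopf_bialgebra :> bialgebra H;
  antipode : {linear H -> H};
  hopf_antipodel : forall x,
    \sw_(x1, x2 <- x) antipode x1 ·[hopf_bialgebra] x2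
    = counit x *: one hopf_bialgebra;
  hopf_antipoder : forall x,
    \sw_(x1, x2 <- x) x1 ·[hopf_bialgebra] antipode x2
    = counit x *: one hopf_bialgebra
}.

Record hopf_brace (k : fieldType) (H : coalgType k) := HopfBrace {
  dot : hopf_algebra H;
  circ : hopf_algebra H;
  hopf_brace_compat : forall x y z,
    x ·[circ] (y ·[dot] z)
    = \sw_(x1, x2, x3 <- x)
        (x1 ·[circ] y) ·[dot] antipode dot x2 ·[dot] (x3 ·[circ] z)
}.

Section Modules.
Variables (k : fieldType) (K : coalgType k) (hK : bialgebra K).

Definition left_module (M : lmodType k) (act : {linear (K ⊗ M)%type -> M}) : Prop :=
  (forall x y m, act ((x ·[hK] y) ⊗ m) = act (x ⊗ act (y ⊗ m))) /\
  (forall m, act (one hK ⊗ m) = m).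

Definition right_module (M : lmodType k) (act : {linear (M ⊗ K)%type -> M}) : Prop :=
  (forall m x y, act (m ⊗ (x ·[hK] y)) = act (act (m ⊗ x) ⊗ y)) /\
  (forall m, act (m ⊗ one hK) = m).

Definition left_module_coalgebra (C : coalgType k)
    (act : {linear (K ⊗ C)%type -> C}) : Prop :=
  left_module act /\ coalgebra_map act.

Definition right_module_coalgebra (C : coalgType k)
    (act : {linear (C ⊗ K)%type -> C}) : Prop :=
  right_module act /\ coalgebra_map act.

Definition left_module_bialgebra (A : coalgType k) (hA : bialgebra A)
    (act : {linear (K ⊗ A)%type -> A}) : Prop :=
  [/\ left_module_coalgebra act,
      forall x a b, act (x ⊗ (a ·[hA] b))
        = \sw_(x1, x2 <- x) act (x1 ⊗ a) ·[hA] act (x2 ⊗ b)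
    & forall x, act (x ⊗ one hA) = counit x *: one hA].

End Modules.

(* [rt] is [▷] and [lt] is [◁]. *)
Record matched_pair (k : fieldType) (A H : coalgType k)
    (hA : hopf_algebra A) (hH : hopf_algebra H)
    (rt : {linear (H ⊗ A)%type -> A}) (lt : {linear (H ⊗ A)%type -> H}) : Prop :=
  MatchedPair {
  matched_left : left_module_coalgebra hH rt;
  matched_right : right_module_coalgebra hA lt;
  matched_rt1 : forall x, rt (x ⊗ one hA) = counit x *: one hA;
  matched_lt1 : forall a, lt (one hH ⊗ a) = counit a *: one hH;
  matched_rtM : forall x a b,
    rt (x ⊗ (a ·[hA] b))
    = \sw_(x1, x2 <- x) \sw_(a1, a2 <- a)
        rt (x1 ⊗ a1) ·[hA] rt (lt (x2 ⊗ a2) ⊗ b);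
  matched_ltM : forall x y a,
    lt ((x ·[hH] y) ⊗ a)
    = \sw_(y1, y2 <- y) \sw_(a1, a2 <- a)
        lt (x ⊗ rt (y1 ⊗ a1)) ·[hH] lt (y2 ⊗ a2);
  matched_comm : forall x a,
    \sw_(x1, x2 <- x) \sw_(a1, a2 <- a) lt (x1 ⊗ a1) ⊗ rt (x2 ⊗ a2)
    = \sw_(x1, x2 <- x) \sw_(a1, a2 <- a) lt (x2 ⊗ a2) ⊗ rt (x1 ⊗ a1)
}.

(* Main.v *)
From HB Require Import structures.
Require Import Defs.
From mathcomp Require Import all_boot all_algebra ring.
Local Open Scope ring_scope.

Set Implicit Arguments.
Unset Strict Implicit.
Unset Printing Implicit Defensive.

Import GRing.Theory.

(* The first product is the bicrossed product of the matched pair; as H is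
   cocommutative, the second is the bicrossed product of the matched pair
   formed by the action ▶ of H_∘ and the trivial right action.  Writing j x for
   1 ⊗ x, a ⊗ x = (a ⊗ 1) (j x) and S (a ⊗ x) = j (S x) (S a ⊗ 1), so the
   factors from A cancel and the brace identity reduces to
     j x ∘ (u v) = (j x1 ∘ u) j (S x2) (j x3 ∘ v).
   Its core is the identity
     x1 ▶ (y1 ▷ c1) ⊗ (x2 ∘ (y2 ◁ c2)) S(x3)
       = j ((x1 ∘ y) S(x2)) (x3 ▶ c ⊗ 1),
   which the two hypotheses give because (x, y) ↦ (x1 ∘ y) S(x2) is compatible
   with coproducts, S being a coalgebra map on the cocommutative H. *)

(** * Sweedler calculus *)

Section Linearity.
Variable k : fieldType.
Implicit Types U V W : lmodType k.

Lemma linear_comp U V W (L : {linear V -> W}) (g : U -> V) :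
  linear g -> linear (fun u => L (g u)).
Proof. by move=> gl a u v; rewrite gl linearP. Qed.

Lemma linear_comp_fun U V W (f : V -> W) (g : U -> V) :
  linear f -> linear g -> linear (fun u => f (g u)).
Proof. by move=> fl gl a u v; rewrite gl fl. Qed.

Lemma linear_scaler U V a (g : U -> V) :
  linear g -> linear (fun u => a *: g u).
Proof. by move=> gl b u v; rewrite gl scalerDr !scalerA mulrC. Qed.

Lemma linear_scalel (C : coalgType k) U V (g : U -> C) (v : V) :
  linear g -> linear (fun u => counit (g u) *: v).
Proof. by move=> gl b u w; rewrite gl linearP scalerDl scalerA. Qed.

End Linearity.

(** * Tactics for linearity goals and for rearranging Sweedler sums *)

Ltac is_constant f :=
  assert_succeeds (
    assert (forall w w', f w = f w');
    [intros ? ?; cbv beta; lazymatch goal with |- ?l = ?r => constr_eq l r end|]).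

(** Linearity is read off the syntax: each case strips the outermost operation and recurses into the
    argument that contains the variable, which [is_constant] detects. If the variable sits in the
    tensor of a [tsum], bilinearity of the summand is a further goal. *)
Ltac lin :=
  cbv beta;
  lazymatch goal with
  | |- bilinear_for _ _ _ => split=> ?; lin
  | |- forall _, _ => intro; lin
  | |- GRing.linear_for _ (fun w => w) => exact: linear_id
  | |- GRing.linear_for _ (fun w => @tsum _ _ _ _ _ (@?t w)) =>
      tryif is_constant t then apply: tsum_linear_param else apply: tsum_linear_comp; lin
  | |- GRing.linear_for _ (fun w => @tens _ _ _ (@?u w) _) =>
      tryif is_constant u then apply: tens_linearr else apply: tens_linearl; lin
  | |- GRing.linear_for _ (fun w => @GRing.scale _ _ (@?a w) _) =>
      tryif is_constant a then apply: linear_scaler else apply: linear_scalel; lin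
  | |- GRing.linear_for _ (fun w => @GRing.Linear.sort _ _ _ _ _ _) =>
      apply: linear_comp; lin
  | |- GRing.linear_for _ (fun w => ?f w) => change (linear f); lin
  | |- GRing.linear_for _ (@GRing.Linear.sort _ _ _ _ _) => exact: linearP
  | |- GRing.linear_for _ (@tens _ _ _ _) => apply: tens_linearr; exact: linear_id
  | |- GRing.linear_for _ (@tsum _ _ _ _ _) => apply: tsum_linear; lin
  | |- _ => solve [eauto]
  end.

(* Solves [E = ?R], where [?R] is [E] with the sum over [comul x] moved to the
   front. *)
Ltac sw_pull x :=
  cbv beta;
  lazymatch goal with
  | |- tsum _ (GRing.Linear.sort _ x) = _ => reflexivity
  | |- tsum _ _ = _ =>
      etransitivity;
      [refine (eq_tsum _ _); intros ? ?; sw_pull x | refine (exchange_tsum _ _ _)]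
  end.

(* Solves [E = ?R], where the sums of [?R] over the iterated coproduct of [x]
   come first and are bracketed to the right. *)
Ltac sw_comb x :=
  etransitivity; [sw_pull x | sw_comb_front]
with sw_comb_front :=
  cbv beta;
  lazymatch goal with
  | |- tsum _ _ = _ =>
  first
  [ etransitivity;
    [ etransitivity;
      [refine (eq_tsum _ _); let u := fresh in let v := fresh in intros u v; sw_pull u
      | refine (sweedlerA _ _ _ _); lin]
    | sw_comb_front ]
  | refine (eq_tsum _ _);
    let u := fresh in let v := fresh in intros u v; first [sw_comb v | reflexivity]]
  end.

Tactic Notation "sweedler" constr(x) := etransitivity; [sw_comb x|]; cbv beta.

(* Solves [E = ?R] by moving all sums in [E] to the front. *)
Ltac prenex :=
  cbv beta;
  lazymatch goal with
  | |- tsum _ _ = _ => refine (eq_tsum _ _); intros ? ?; prenex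
  | |- ?E = _ =>
      lazymatch E with
      | context [@tsum ?k ?U ?V ?W ?f ?t] =>
          let L := eval pattern (@tsum k U V W f t) in E in
          lazymatch L with
          | ?L _ => etransitivity;
              [refine (@linear_tsum k U V W _ L f t _); lin | prenex]
          end
      | _ => reflexivity
      end
  end.

(* Applies [tac] under as few of the outer sums as possible; [tac] has to solve
   a goal [E = ?R]. *)
Ltac under_sums tac :=
  cbv beta;
  first [tac | refine (eq_tsum _ _); intros ? ?; under_sums tac].

Tactic Notation "sw" tactic3(tac) :=
  etransitivity; [under_sums ltac:(tac)|]; cbv beta.

Ltac tens_ext :=
  lazymatch goal with
  | |- forall t, @?f t = @?g t => refine (@linear_tens_ext _ _ _ _ f g _ _ _)
  end;
  [rewrite /sweedler3; lin|rewrite /sweedler3; lin|].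

Ltac sw_intro := repeat (refine (eq_tsum _ _); intros ? ?); cbv beta.

Lemma coalgebra_mapD (k : fieldType) (C D : coalgType k) (W : lmodType k)
    (f : {linear C -> D}) (g : D -> D -> W) :
  coalgebra_map f -> bilinear_for *:%R *:%R g ->
  forall c, \sw_(e1, e2 <- f c) g e1 e2 = \sw_(c1, c2 <- c) g (f c1) (f c2).
Proof.
case=> fD _ gb c.
rewrite fD tsum_tsum; last exact: gb.
by apply: eq_tsum => ? ?; rewrite tsum_tens.
Qed.

Lemma sw_tens (k : fieldType) (C D : coalgType k) (W : lmodType k)
    (g : (C ⊗ D)%type -> (C ⊗ D)%type -> W) c d : bilinear_for *:%R *:%R g ->
  \sw_(t1, t2 <- c ⊗ d) g t1 t2 =
  \sw_(c1, c2 <- c) \sw_(d1, d2 <- d) g (c1 ⊗ d1) (c2 ⊗ d2).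
Proof. exact: tsum_tens_comul. Qed.

(** The legs of [f (c ⊗ d)] are obtained by splitting [c] and [d] in parallel; coproducts of
    products and of actions are expanded this way below. *)
Lemma sw_map2 (k : fieldType) (C D E : coalgType k) (W : lmodType k)
    (f : {linear (C ⊗ D)%type -> E}) (g : E -> E -> W) c d :
  coalgebra_map f -> bilinear_for *:%R *:%R g ->
  \sw_(e1, e2 <- f (c ⊗ d)) g e1 e2 =
  \sw_(c1, c2 <- c) \sw_(d1, d2 <- d) g (f (c1 ⊗ d1)) (f (c2 ⊗ d2)).
Proof.
move=> cm gb.
rewrite (coalgebra_mapD cm gb).
refine (sw_tens (g := fun x y => g (f x) (f y)) c d _).
case: gb => gl gr; split=> [t|t].
  exact: (linear_comp_fun (gl (f t)) (linearP f)).
exact: (linear_comp_fun (gr (f t)) (linearP f)).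
Qed.

(** * Counit axioms, coalgebra maps and antipode axioms inside linear expressions *)

Section Counit.
Variables (k : fieldType) (C : coalgType k) (W : lmodType k) (f : C -> W).
Hypothesis fl : linear f.

Lemma sw_counitl c : \sw_(c1, c2 <- c) counit c1 *: f c2 = f c.
Proof.
rewrite -[in RHS](counitl c) (linear_tsum _ _ fl).
by apply: eq_tsum => c1 c2; rewrite (GRing.scalable_linear fl).
Qed.

Lemma sw_counitr c : \sw_(c1, c2 <- c) counit c2 *: f c1 = f c.
Proof.
rewrite -[in RHS](counitr c) (linear_tsum _ _ fl).
by apply: eq_tsum => c1 c2; rewrite (GRing.scalable_linear fl).
Qed.

End Counit.

Lemma sw_counit2 (k : fieldType) (C D : coalgType k) (W : lmodType k) (w : W)
    (c : C) (d : D) :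
  \sw_(c1, c2 <- c) \sw_(d1, d2 <- d)
    counit d1 *: (counit d2 *: (counit c1 *: (counit c2 *: w))) =
  counit d *: (counit c *: w).
Proof.
sw (refine (sw_counitl (f := fun d => counit d *: _) _ _); lin).
sw (rewrite scalerA mulrC -scalerA; reflexivity).
by apply: (sw_counitl (f := fun c => _ *: (counit c *: _))); lin.
Qed.

Section Scale.
Variables (k : fieldType) (U V W : lmodType k) (f : {linear (U ⊗ V)%type -> W}).

Lemma tensKZl a u v : f ((a *: u) ⊗ v) = a *: f (u ⊗ v).
Proof. by rewrite tensZl linearZ. Qed.

Lemma tensKZr a u v : f (u ⊗ (a *: v)) = a *: f (u ⊗ v).
Proof. by rewrite tensZr linearZ. Qed.

End Scale.

Lemma comul_tens (k : fieldType) (C D : coalgType k) (c : C) (d : D) :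
  comul (c ⊗ d) = \sw_(c1, c2 <- c) \sw_(d1, d2 <- d) (c1 ⊗ d1) ⊗ (c2 ⊗ d2).
Proof. exact: tens_comulE. Qed.

Lemma counit_tens (k : fieldType) (C D : coalgType k) (c : C) (d : D) :
  counit (c ⊗ d) = counit c * counit d.
Proof. exact: tens_counitE. Qed.

Lemma coalgebra_map_counit (k : fieldType) (C D : coalgType k)
    (f : {linear C -> D}) :
  coalgebra_map f -> forall c, counit (f c) = counit c.
Proof. by case. Qed.

Lemma counit_map2 (k : fieldType) (C D E : coalgType k)
    (f : {linear (C ⊗ D)%type -> E}) c d :
  coalgebra_map f -> counit (f (c ⊗ d)) = counit c * counit d.
Proof.
move=> cm; etransitivity; [exact: (coalgebra_map_counit cm)|exact: counit_tens].
Qed.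

(** This condition is closed under sums in [c], so on a tensor product it can be checked on pure
    tensors by [tens_ind]. *)
Definition coalgebra_map_at (k : fieldType) (C D : coalgType k)
    (f : {linear C -> D}) (c : C) : Prop :=
  comul (f c) = \sw_(c1, c2 <- c) f c1 ⊗ f c2 /\ counit (f c) = counit c.

Lemma coalgebra_map_atD (k : fieldType) (C D : coalgType k)
    (f : {linear C -> D}) c d :
  coalgebra_map_at f c -> coalgebra_map_at f d -> coalgebra_map_at f (c + d).
Proof.
have fl : linear (fun c => \sw_(c1, c2 <- c) f c1 ⊗ f c2) by lin.
move=> [cD ce] [dD de]; split; last by rewrite !linearD ce de.
by have /= := fl 1 c d; rewrite !scale1r => ->; rewrite !linearD cD dD.
Qed.

Lemma coalgebra_map_atP (k : fieldType) (C D : coalgType k)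
    (f : {linear C -> D}) :
  (forall c, coalgebra_map_at f c) -> coalgebra_map f.
Proof. by move=> fc; split=> c; case: (fc c). Qed.

(** The universal property of the tensor product, used to carry an equation between tensors over to
    any bilinear expression. *)
Lemma linear_lift (k : fieldType) (U V W : lmodType k) (g : U -> V -> W) :
  bilinear_for *:%R *:%R g ->
  {L : {linear (U ⊗ V)%type -> W} | forall u v, L (u ⊗ v) = g u v}.
Proof.
move=> gb.
pose L := GRing.isLinear.Build k _ _ _ (tsum g) (tsum_linear gb).
pose Ll : {linear (U ⊗ V)%type -> W} := HB.pack (tsum g) L.
by exists Ll => u v; exact: tsum_tens.
Qed.

Section Antipode.
Variables (k : fieldType) (H : coalgType k) (hH : hopf_algebra H).
Variables (W : lmodType k) (f : H -> W).
Hypothesis fl : linear f.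

Lemma sw_antipodel x :
  \sw_(x1, x2 <- x) f (antipode hH x1 ·[hH] x2) = counit x *: f (Defs.one hH).
Proof.
by rewrite -(GRing.scalable_linear fl) -hopf_antipodel (linear_tsum _ _ fl).
Qed.

Lemma sw_antipoder x :
  \sw_(x1, x2 <- x) f (x1 ·[hH] antipode hH x2) = counit x *: f (Defs.one hH).
Proof.
by rewrite -(GRing.scalable_linear fl) -hopf_antipoder (linear_tsum _ _ fl).
Qed.

End Antipode.

(** * Bicrossed products *)

Section BicrossedProduct.
Variables (k : fieldType) (A H : coalgType k).
Variables (hA : bialgebra A) (hH : bialgebra H).
Variables (rt : {linear (H ⊗ A)%type -> A}) (lt : {linear (H ⊗ A)%type -> H}).

Definition bicrossed_fun (t : ((A ⊗ H) ⊗ (A ⊗ H))%type) : (A ⊗ H)%type :=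
  \tsum_(u ⊗ v <- t) \tsum_(a ⊗ x <- u) \tsum_(b ⊗ y <- v)
    \sw_(x1, x2 <- x) \sw_(b1, b2 <- b)
      (a ·[hA] rt (x1 ⊗ b1)) ⊗ (lt (x2 ⊗ b2) ·[hH] y).

Lemma bicrossed_fun_linear : linear bicrossed_fun.
Proof. rewrite /bicrossed_fun; lin. Qed.

HB.instance Definition _ := GRing.isLinear.Build k _ _ _
  bicrossed_fun bicrossed_fun_linear.

Definition bicrossed_mul : {linear ((A ⊗ H) ⊗ (A ⊗ H))%type -> (A ⊗ H)%type} :=
  bicrossed_fun.

Lemma bicrossed_mulE a x b y : bicrossed_mul ((a ⊗ x) ⊗ (b ⊗ y)) =
  \sw_(x1, x2 <- x) \sw_(b1, b2 <- b)
    (a ·[hA] rt (x1 ⊗ b1)) ⊗ (lt (x2 ⊗ b2) ·[hH] y).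
Proof.
rewrite /= /bicrossed_fun tsum_tens; last by lin.
rewrite tsum_tens; last by lin.
by rewrite tsum_tens; last by lin.
Qed.

End BicrossedProduct.

(** * The Hopf algebra structure on the bicrossed product of a matched pair *)

Section BicrossedHopf.
Variables (k : fieldType) (A H : coalgType k).
Variables (hA : hopf_algebra A) (hH : hopf_algebra H).
Variables (rt : {linear (H ⊗ A)%type -> A}) (lt : {linear (H ⊗ A)%type -> H}).
Hypothesis mp : matched_pair hA hH rt lt.
Local Notation m := (bicrossed_mul hA hH rt lt).

Let rtA x y a : rt ((x ·[hH] y) ⊗ a) = rt (x ⊗ rt (y ⊗ a)).
Proof. by case: mp => -[[]]. Qed.
Let rt1 a : rt (Defs.one hH ⊗ a) = a.
Proof. by case: mp => -[[]]. Qed.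
Let ltA x a b : lt (x ⊗ (a ·[hA] b)) = lt (lt (x ⊗ a) ⊗ b).
Proof. by case: mp => _ [[]]. Qed.
Let lt1 x : lt (x ⊗ Defs.one hA) = x.
Proof. by case: mp => _ [[]]. Qed.
Let rtD : coalgebra_map rt.
Proof. by case: mp => -[]. Qed.
Let ltD : coalgebra_map lt.
Proof. by case: mp => _ []. Qed.
Let mulAD := bialg_mul_coalgebra_map hA.
Let mulHD := bialg_mul_coalgebra_map hH.

(** Both bracketings expand to a (x1 ▷ b1) ((x2 ◁ b2) ▷ (y1 ▷ c1)) ⊗ ((x3 ◁ b3) ◁ (y2 ▷ c2)) (y3 ◁
    c3) z: the left one by [matched_ltM], the right one by [matched_rtM], together with the module
    axioms. *)
Lemma bicrossed_mulA_tens a x b y c z :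
  m (m ((a ⊗ x) ⊗ (b ⊗ y)) ⊗ (c ⊗ z)) = m ((a ⊗ x) ⊗ m ((b ⊗ y) ⊗ (c ⊗ z))).
Proof.
sw (rewrite bicrossed_mulE; prenex).
sw (rewrite bicrossed_mulE; prenex).
sw (refine (sw_map2 _ _ mulHD _); lin).
sw (refine (sw_map2 _ _ ltD _); lin).
sw (rewrite rtA; prenex).
sw (rewrite (matched_ltM mp); prenex).
sweedler c.
sweedler y.
sweedler b.
sweedler x.
symmetry.
sw (rewrite [X in _ ⊗ X]bicrossed_mulE; prenex).
sw (rewrite bicrossed_mulE; prenex).
sw (refine (sw_map2 _ _ mulAD _); lin).
sw (refine (sw_map2 _ _ rtD _); lin).
sw (rewrite ltA (matched_rtM mp); prenex).
sweedler c.
sweedler y.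
sweedler b.
sweedler x.
by sw_intro; rewrite !bialg_mulA.
Qed.

Lemma bicrossed_mulA s t u : m (m (s ⊗ t) ⊗ u) = m (s ⊗ m (t ⊗ u)).
Proof.
move: s; tens_ext => a x.
move: t; tens_ext => b y.
move: u; tens_ext => c z.
exact: bicrossed_mulA_tens.
Qed.

Local Notation e := (Defs.one hA ⊗ Defs.one hH).

Lemma bicrossed_mul1l t : m (e ⊗ t) = t.
Proof.
move: t; tens_ext => b y.
rewrite bicrossed_mulE bialg_comul1 tsum_tens; last by lin.
sw (rewrite rt1 (matched_lt1 mp) bialg_mul1l tensKZl bialg_mul1l tensZr; reflexivity).
by apply: sw_counitr; lin.
Qed.

Lemma bicrossed_mul1r t : m (t ⊗ e) = t.
Proof.
move: t; tens_ext => a x.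
rewrite bicrossed_mulE bialg_comul1.
sw (rewrite tsum_tens; [reflexivity|lin]).
sw (rewrite lt1 (matched_rt1 mp) bialg_mul1r tensKZr bialg_mul1r tensZl; reflexivity).
by apply: sw_counitl; lin.
Qed.

Lemma matched_comm_bilinear (W : lmodType k) (g : H -> A -> W) x a :
  bilinear_for *:%R *:%R g ->
  \sw_(x1, x2 <- x) \sw_(a1, a2 <- a) g (lt (x1 ⊗ a1)) (rt (x2 ⊗ a2)) =
  \sw_(x1, x2 <- x) \sw_(a1, a2 <- a) g (lt (x2 ⊗ a2)) (rt (x1 ⊗ a1)).
Proof.
move=> gb; have [L LE] := linear_lift gb.
transitivity (L (\sw_(x1, x2 <- x) \sw_(a1, a2 <- a) lt (x1 ⊗ a1) ⊗ rt (x2 ⊗ a2))).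
  by symmetry; sw prenex; sw_intro; exact: LE.
rewrite (matched_comm mp).
by sw prenex; sw_intro; exact: LE.
Qed.

(** On the left ▷ receives the legs 1, 2 and ◁ the legs 3, 4 of [x] and [b]; on the right they
    receive 1, 3 and 2, 4. The axiom [matched_comm] accounts for the difference. *)
Lemma bicrossed_comul a x b y :
  comul (m ((a ⊗ x) ⊗ (b ⊗ y))) =
  \sw_(s1, s2 <- a ⊗ x) \sw_(t1, t2 <- b ⊗ y) m (s1 ⊗ t1) ⊗ m (s2 ⊗ t2).
Proof.
(* The bracketing makes the legs 2 and 3 the coproduct of a single element, as [matched_comm]
   requires. *)
transitivity (\sw_(a1, a2 <- a) \sw_(y1, y2 <- y)
  \sw_(x1, x' <- x) \sw_(b1, b' <- b) \sw_(x'', x4 <- x') \sw_(b'', b4 <- b')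
  \sw_(x2, x3 <- x'') \sw_(b2, b3 <- b'')
    ((a1 ·[hA] rt (x1 ⊗ b1)) ⊗ (lt (x3 ⊗ b3) ·[hH] y1))
    ⊗ ((a2 ·[hA] rt (x2 ⊗ b2)) ⊗ (lt (x4 ⊗ b4) ·[hH] y2))).
  sw (rewrite bicrossed_mulE; prenex).
  sw (rewrite comul_tens; prenex).
  sw (refine (sw_map2 _ _ mulAD _); lin).
  sw (refine (sw_map2 _ _ mulHD _); lin).
  sw (refine (sw_map2 _ _ rtD _); lin).
  sw (refine (sw_map2 _ _ ltD _); lin).
  sweedler x.
  sweedler b.
  sweedler y.
  sweedler a.
  symmetry.
  sweedler x.
  sweedler b.
  sweedler y.
  sweedler a.
  reflexivity.
transitivity (\sw_(a1, a2 <- a) \sw_(y1, y2 <- y)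
  \sw_(x1, x' <- x) \sw_(b1, b' <- b) \sw_(x'', x4 <- x') \sw_(b'', b4 <- b')
  \sw_(x2, x3 <- x'') \sw_(b2, b3 <- b'')
    ((a1 ·[hA] rt (x1 ⊗ b1)) ⊗ (lt (x2 ⊗ b2) ·[hH] y1))
    ⊗ ((a2 ·[hA] rt (x3 ⊗ b3)) ⊗ (lt (x4 ⊗ b4) ·[hH] y2))).
  (* Only the middle two of the four legs of x and of b are concerned. *)
  do 6!(apply: eq_tsum => ? ?).
  symmetry.
  refine (matched_comm_bilinear (g := fun h c =>
    ((_ ·[hA] _) ⊗ (h ·[hH] _)) ⊗ ((_ ·[hA] c) ⊗ (_ ·[hH] _))) _ _ _).
  lin.
symmetry.
sw (refine (sw_tens _ _ _); lin).
sw (refine (sw_tens _ _ _); lin).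
sw (rewrite bicrossed_mulE; prenex).
sw (rewrite bicrossed_mulE; prenex).
sweedler x.
sweedler b.
sweedler y.
sweedler a.
symmetry.
sweedler x.
sweedler b.
sweedler y.
sweedler a.
reflexivity.
Qed.

Lemma bicrossed_counit a x b y :
  counit (m ((a ⊗ x) ⊗ (b ⊗ y))) = counit (a ⊗ x) * counit (b ⊗ y).
Proof.
rewrite bicrossed_mulE !counit_tens.
(* Written as nested scalars on the regular module [k^o], the counits can be expanded by
   [sw_counit2], read backwards, into the Sweedler sums of the product. *)
have -> : counit a * counit x * (counit b * counit y) =
    counit b *: (counit x *: (counit a * counit y : k^o)).
  by rewrite /GRing.scale /=; ring.
rewrite -sw_counit2.
rewrite (@linear_tsum _ _ _ _ k^o counit); last exact: linearP.
refine (@eq_tsum k _ _ k^o _ _ _ _) => x1 x2.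
rewrite (@linear_tsum _ _ _ _ k^o counit); last exact: linearP.
refine (@eq_tsum k _ _ k^o _ _ _ _) => b1 b2.
rewrite counit_tens (counit_map2 _ _ mulAD) (counit_map2 _ _ mulHD).
rewrite (counit_map2 _ _ rtD) (counit_map2 _ _ ltD) /GRing.scale /=.
by rewrite [_ * counit y]mulrC; ring.
Qed.

Lemma bicrossed_coalgebra_map : coalgebra_map m.
Proof.
apply: coalgebra_map_atP; elim/tens_ind => [s t|]; last exact: coalgebra_map_atD.
elim/tens_ind: s => [a x|s s'].
  elim/tens_ind: t => [b y|t t'].
    split.
      rewrite bicrossed_comul; symmetry.
      by refine (sw_tens (g := fun s t => m s ⊗ m t) _ _ _); lin.
    by rewrite bicrossed_counit [RHS]counit_tens.
  by rewrite tensDr; exact: coalgebra_map_atD.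
by rewrite tensDl; exact: coalgebra_map_atD.
Qed.

Lemma bicrossed_comul1 : comul e = e ⊗ e.
Proof.
rewrite comul_tens !bialg_comul1 tsum_tens; last by lin.
by rewrite tsum_tens; last by lin.
Qed.

Lemma bicrossed_counit1 : counit e = 1.
Proof. by rewrite counit_tens !bialg_counit1 mulr1. Qed.

Definition bicrossed_bialgebra : bialgebra (A ⊗ H)%type :=
  Bialgebra bicrossed_mulA bicrossed_mul1l bicrossed_mul1r
    bicrossed_coalgebra_map bicrossed_comul1 bicrossed_counit1.

Lemma bicrossed_mul_inl a b y :
  m ((a ⊗ Defs.one hH) ⊗ (b ⊗ y)) = (a ·[hA] b) ⊗ y.
Proof.
rewrite bicrossed_mulE bialg_comul1 tsum_tens; last by lin.
sw (rewrite rt1 (matched_lt1 mp) tensKZl bialg_mul1l tensZr; reflexivity).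
by apply: (sw_counitr (f := fun b => (a ·[hA] b) ⊗ y)); lin.
Qed.

Lemma bicrossed_mul_inr a x y :
  m ((a ⊗ x) ⊗ (Defs.one hA ⊗ y)) = a ⊗ (x ·[hH] y).
Proof.
rewrite bicrossed_mulE bialg_comul1.
sw (rewrite tsum_tens; [reflexivity|lin]).
sw (rewrite lt1 (matched_rt1 mp) tensKZr bialg_mul1r tensZl; reflexivity).
by apply: (sw_counitl (f := fun x => a ⊗ (x ·[hH] y))); lin.
Qed.

(** An antipode reverses products, and a ⊗ x = (a ⊗ 1) (1 ⊗ x), which forces this formula. *)
Definition bicrossed_antipode_fun (t : (A ⊗ H)%type) : (A ⊗ H)%type :=
  \tsum_(a ⊗ x <- t)
    m ((Defs.one hA ⊗ antipode hH x) ⊗ (antipode hA a ⊗ Defs.one hH)).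

Lemma bicrossed_antipode_linear : linear bicrossed_antipode_fun.
Proof. rewrite /bicrossed_antipode_fun; lin. Qed.

HB.instance Definition _ := GRing.isLinear.Build k _ _ _
  bicrossed_antipode_fun bicrossed_antipode_linear.

Definition bicrossed_antipode : {linear (A ⊗ H)%type -> (A ⊗ H)%type} :=
  bicrossed_antipode_fun.

Lemma bicrossed_antipodeE a x : bicrossed_antipode (a ⊗ x) =
  m ((Defs.one hA ⊗ antipode hH x) ⊗ (antipode hA a ⊗ Defs.one hH)).
Proof. by rewrite /= /bicrossed_antipode_fun tsum_tens; last by lin. Qed.

(** In (1 ⊗ S x1) (S a1 ⊗ 1) (a2 ⊗ x2) the factors from [A] are adjacent and cancel first, then
    those from [H]. For the right antipode axiom the order is reversed. *)
Lemma bicrossed_antipodel t :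
  \sw_(t1, t2 <- t) m (bicrossed_antipode t1 ⊗ t2) = counit t *: e.
Proof.
move: t; tens_ext => a x.
rewrite sw_tens; last by lin.
sw (rewrite bicrossed_antipodeE bicrossed_mulA bicrossed_mul_inl; reflexivity).
sweedler x.
sw (refine (sw_antipodel (f := fun c => m (_ ⊗ (c ⊗ _))) _ _ _); lin).
sw (rewrite bicrossed_mul_inr; reflexivity).
etransitivity; [refine (sw_antipodel (f := fun h => _ *: (_ ⊗ h)) _ _ _); lin|].
by rewrite scalerA mulrC counit_tens.
Qed.

Lemma bicrossed_antipoder t :
  \sw_(t1, t2 <- t) m (t1 ⊗ bicrossed_antipode t2) = counit t *: e.
Proof.
move: t; tens_ext => a x.
rewrite sw_tens; last by lin.
sw (rewrite bicrossed_antipodeE -bicrossed_mulA bicrossed_mul_inr; reflexivity).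
sw (refine (sw_antipoder (f := fun h => m ((_ ⊗ h) ⊗ _)) _ _ _); lin).
sw (rewrite bicrossed_mul_inl; reflexivity).
etransitivity; [refine (sw_antipoder (f := fun c => _ *: (c ⊗ _)) _ _ _); lin|].
by rewrite scalerA counit_tens.
Qed.

Definition bicrossed_hopf : hopf_algebra (A ⊗ H)%type :=
  @HopfAlgebra k (A ⊗ H)%type bicrossed_bialgebra bicrossed_antipode
    bicrossed_antipodel bicrossed_antipoder.

End BicrossedHopf.

(** * Cocommutative Hopf algebras and smash products *)

Section Cocommutative.
Variables (k : fieldType) (C : coalgType k).
Hypothesis cC : cocommutative C.

Lemma sw_cocomm (W : lmodType k) (f : C -> C -> W) c :
  bilinear_for *:%R *:%R f ->
  \sw_(c1, c2 <- c) f c1 c2 = \sw_(c1, c2 <- c) f c2 c1.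
Proof.
move=> fb; rewrite [in LHS](cC c) tsum_tsum; last exact: fb.
by apply: eq_tsum => ? ?; rewrite tsum_tens.
Qed.

(** Bracketed to the left, the first two legs are the coproduct of one element, to which
    cocommutativity applies. *)
Lemma sw_swap (W : lmodType k) (f : C -> C -> C -> W) c :
  (forall y z, linear (fun x => f x y z)) ->
  (forall x z, linear (fun y => f x y z)) ->
  (forall x y, linear (f x y)) ->
  \sw_(c1, y <- c) \sw_(c2, c3 <- y) f c1 c2 c3 =
  \sw_(c1, y <- c) \sw_(c2, c3 <- y) f c2 c1 c3.
Proof.
move=> f1 f2 f3.
transitivity (\sw_(y, c3 <- c) \sw_(c1, c2 <- y) f c1 c2 c3).
  by symmetry; exact: sweedlerA.
transitivity (\sw_(y, c3 <- c) \sw_(c1, c2 <- y) f c2 c1 c3).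
  by apply: eq_tsum => y c3; apply: sw_cocomm; split.
by refine (sweedlerA (K := fun x y z => f y x z) _ _ _ _) => *.
Qed.

End Cocommutative.

(* Exchanges the legs [n] and [n + 1] of the first variable of a goal brought
   to the normal form of [sweedler]. *)
Tactic Notation "sw_exchange" constr(cC) "at" integer(n) :=
  etransitivity;
  [do n (refine (eq_tsum _ _); intros ? ?); cbv beta;
   refine (sw_swap cC _ _ _ _); lin|];
  cbv beta.

Lemma comul_eta (k : fieldType) (E : coalgType k) (c : E) :
  \sw_(c1, c2 <- c) c1 ⊗ c2 = comul c.
Proof.
move: (comul c); tens_ext => u v.
by rewrite tsum_tens; last by lin.
Qed.

(** * Trivial actions through the counit *)

Section TrivialActions.
Variables (k : fieldType) (C D : coalgType k).

Definition trivial_left_fun (t : (C ⊗ D)%type) : D :=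
  \tsum_(c ⊗ d <- t) counit c *: d.

Definition trivial_right_fun (t : (C ⊗ D)%type) : C :=
  \tsum_(c ⊗ d <- t) counit d *: c.

Lemma trivial_left_linear : linear trivial_left_fun.
Proof. rewrite /trivial_left_fun; lin. Qed.
Lemma trivial_right_linear : linear trivial_right_fun.
Proof. rewrite /trivial_right_fun; lin. Qed.

HB.instance Definition _ := GRing.isLinear.Build k _ _ _
  trivial_left_fun trivial_left_linear.
HB.instance Definition _ := GRing.isLinear.Build k _ _ _
  trivial_right_fun trivial_right_linear.

Definition trivial_left : {linear (C ⊗ D)%type -> D} := trivial_left_fun.
Definition trivial_right : {linear (C ⊗ D)%type -> C} := trivial_right_fun.

Lemma trivial_leftE c d : trivial_left (c ⊗ d) = counit c *: d.
Proof. by rewrite /= /trivial_left_fun tsum_tens; last by lin. Qed.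
Lemma trivial_rightE c d : trivial_right (c ⊗ d) = counit d *: c.
Proof. by rewrite /= /trivial_right_fun tsum_tens; last by lin. Qed.

Lemma trivial_left_coalgebra_map : coalgebra_map trivial_left.
Proof.
split.
  tens_ext => c d.
  rewrite sw_tens; last by lin.
  symmetry.
  sw (rewrite !trivial_leftE tensZl tensZr; reflexivity).
  etransitivity; [exact: exchange_tsum|].
  sw (refine (sw_counitl (f := fun c => counit c *: _) _ _); lin).
  by rewrite trivial_leftE linearZZ -[in RHS]comul_eta; symmetry; sw prenex.
elim/tens_ind => [c d|s t Ps Pt]; last by rewrite !linearD Ps Pt.
by rewrite trivial_leftE linearZ counit_tens.
Qed.

Lemma trivial_right_coalgebra_map : coalgebra_map trivial_right.
Proof.
split.
  tens_ext => c d.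
  rewrite sw_tens; last by lin.
  symmetry.
  sw (rewrite !trivial_rightE tensZl tensZr; reflexivity).
  sw (refine (sw_counitl (f := fun c => counit c *: _) _ _); lin).
  by rewrite trivial_rightE linearZZ -[in RHS]comul_eta; symmetry; sw prenex.
elim/tens_ind => [c d|s t Ps Pt]; last by rewrite !linearD Ps Pt.
by rewrite trivial_rightE linearZ counit_tens mulrC.
Qed.

End TrivialActions.

(** * Smash products as bicrossed products with trivial right action *)

Section Smash.
Variables (k : fieldType) (A H : coalgType k).
Variables (hA : hopf_algebra A) (hH : hopf_algebra H).
Variable act : {linear (H ⊗ A)%type -> A}.
Hypothesis cH : cocommutative H.
Hypothesis actB : left_module_bialgebra hH hA act.

(** After the counits are absorbed, the mixed axioms reduce to the module bialgebra axioms, except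
    [matched_comm], which becomes x1 ⊗ act (x2 ⊗ a) = x2 ⊗ act (x1 ⊗ a) and follows from
    cocommutativity. *)
Lemma smash_matched_pair : matched_pair hA hH act (trivial_right H A).
Proof.
case: actB => actC actM act1; split.
- exact: actC.
- split; last exact: trivial_right_coalgebra_map.
  split=> [x a b|x].
    rewrite !trivial_rightE (counit_map2 _ _ (bialg_mul_coalgebra_map hA)).
    by rewrite scalerA mulrC.
  by rewrite trivial_rightE bialg_counit1 scale1r.
- exact: act1.
- by move=> a; rewrite trivial_rightE.
- move=> x a b; rewrite actM.
  apply: eq_tsum => x1 x2; symmetry.
  sw (rewrite trivial_rightE tensKZl tensKZr; reflexivity).
  by apply: (sw_counitr (f := fun a => act (x1 ⊗ a) ·[hA] act (x2 ⊗ b))); lin.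
- move=> x y a; symmetry.
  sw (rewrite !trivial_rightE tensKZl tensKZr; reflexivity).
  sw (rewrite (counit_map2 _ _ actC.2) mulrC -scalerA; reflexivity).
  sw (refine (sw_counitl (f := fun a => _ *: (counit a *: _)) _ _); lin).
  etransitivity; [refine (sw_counitl (f := fun y => _ *: (x ·[hH] y)) _ _); lin|].
  by rewrite trivial_rightE.
- move=> x a.
  sw (rewrite trivial_rightE tensZl; reflexivity).
  sw (refine (sw_counitl (f := fun a => _ ⊗ act (_ ⊗ a)) _ _); lin).
  symmetry.
  sw (rewrite trivial_rightE tensZl; reflexivity).
  sw (refine (sw_counitr (f := fun a => _ ⊗ act (_ ⊗ a)) _ _); lin).
  by refine (sw_cocomm cH (f := fun x y => y ⊗ act (x ⊗ a)) _ _); lin.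
Qed.

Definition smash_hopf : hopf_algebra (A ⊗ H)%type :=
  bicrossed_hopf smash_matched_pair.

End Smash.

(** In the convolution algebra, g = g * (f * h) = (g * f) * h = h. *)
Lemma convolution_inverse_unique (k : fieldType) (C E : coalgType k)
    (hE : bialgebra E) (f g h : C -> E) :
  linear f -> linear g -> linear h ->
  (forall c, \sw_(c1, c2 <- c) g c1 ·[hE] f c2 = counit c *: Defs.one hE) ->
  (forall c, \sw_(c1, c2 <- c) f c1 ·[hE] h c2 = counit c *: Defs.one hE) ->
  g =1 h.
Proof.
move=> fl gl hl gf fh c.
transitivity (\sw_(c1, c2 <- c) \sw_(c21, c22 <- c2) g c1 ·[hE] (f c21 ·[hE] h c22)).
  symmetry.
  transitivity (\sw_(c1, c2 <- c) g c1 ·[hE] (counit c2 *: Defs.one hE)).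
    by apply: eq_tsum => c1 c2; rewrite -fh; symmetry; prenex.
  sw (rewrite tensKZr bialg_mul1r; reflexivity).
  by apply: sw_counitr; lin.
transitivity (\sw_(c1, c2 <- c) \sw_(c11, c12 <- c1) (g c11 ·[hE] f c12) ·[hE] h c2).
  symmetry; etransitivity; [refine (sweedlerA _ _ _ _); lin|].
  by sw_intro; exact: bialg_mulA.
transitivity (\sw_(c1, c2 <- c) (counit c1 *: Defs.one hE) ·[hE] h c2).
  by apply: eq_tsum => c1 c2; rewrite -gf; symmetry; prenex.
sw (rewrite tensKZl bialg_mul1l; reflexivity).
by apply: sw_counitl; lin.
Qed.

(** * The antipode of a cocommutative Hopf algebra respects coproducts *)

Section CocommutativeAntipode.
Variables (k : fieldType) (H : coalgType k) (hH : hopf_algebra H).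
Hypothesis cH : cocommutative H.

(** The smash product for this action is [H ⊗ H] with the componentwise product, the algebra in
    which [comul] takes its values. *)
Lemma trivial_module_bialgebra : left_module_bialgebra hH hH (trivial_left H H).
Proof.
split=> [|x a b|x].
- split; last exact: trivial_left_coalgebra_map.
  split=> [x y a|a].
    rewrite !trivial_leftE (counit_map2 _ _ (bialg_mul_coalgebra_map hH)).
    by rewrite scalerA.
  by rewrite trivial_leftE bialg_counit1 scale1r.
- symmetry.
  sw (rewrite !trivial_leftE tensKZl tensKZr; reflexivity).
  by rewrite sw_counitl ?trivial_leftE; last by lin.
- by rewrite trivial_leftE.
Qed.

Let hHH := smash_hopf cH trivial_module_bialgebra.

Lemma tensor_square_mulE x y x' y' :
  (x ⊗ y) ·[hHH] (x' ⊗ y') = (x ·[hH] x') ⊗ (y ·[hH] y').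
Proof.
etransitivity; [exact: bicrossed_mulE|].
sw (rewrite trivial_leftE trivial_rightE tensKZl tensKZr tensZl tensZr; reflexivity).
etransitivity; [exact: exchange_tsum|].
sw (refine (sw_counitl (f := fun y => counit _ *: (_ ⊗ (y ·[hH] _))) _ _); lin).
by apply: (sw_counitr (f := fun x' => (x ·[hH] x') ⊗ (y ·[hH] y'))); lin.
Qed.

(** Both sides, as functions of [x], are convolution inverses of [comul] with values in the tensor
    square. *)
Lemma comul_antipode x :
  comul (antipode hH x) = \sw_(x1, x2 <- x) antipode hH x1 ⊗ antipode hH x2.
Proof.
symmetry.
have gl : linear (fun x => \sw_(x1, x2 <- x) antipode hH x1 ⊗ antipode hH x2) by lin.
have hl : linear (fun x => comul (antipode hH x)) by lin.
have fl : linear (@comul k H) by lin.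
refine (convolution_inverse_unique (hE := hHH) fl gl hl _ _ x) => {}x.
  transitivity (\sw_(x1, x2 <- x) (\sw_(y1, y2 <- x1) antipode hH y1 ⊗ antipode hH y2)
      ·[hHH] \sw_(z1, z2 <- x2) z1 ⊗ z2).
    by apply: eq_tsum => x1 x2; rewrite comul_eta.
  sw prenex.
  sw (rewrite tensor_square_mulE; reflexivity).
  sweedler x.
  (* Legs are counted from 0 here: the second and third are exchanged, turning S x1 x3 ⊗ S x2 x4
     into S x1 x2 ⊗ S x3 x4. *)
  sw_exchange cH at 1.
  transitivity (\sw_(x1, x2 <- x) \sw_(x11, x12 <- x1) \sw_(x21, x22 <- x2)
     (antipode hH x11 ·[hH] x12) ⊗ (antipode hH x21 ·[hH] x22)).
    symmetry; sweedler x; reflexivity.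
  sw (refine (sw_antipodel (f := fun y => _ ⊗ y) _ _ _); lin).
  sw (refine (sw_antipodel (f := fun y => _ *: (y ⊗ _)) _ _ _); lin).
  by etransitivity; [refine (sw_counitl (f := fun x => counit x *: _) _ _); lin|].
(* The other inverse uses that [comul] is multiplicative. *)
transitivity (\sw_(x1, x2 <- x) comul (x1 ·[hH] antipode hH x2)).
  apply: eq_tsum => x1 x2.
  rewrite -[in LHS](comul_eta x1) -[in LHS](comul_eta (antipode hH x2)).
  sw prenex.
  sw (rewrite tensor_square_mulE; reflexivity).
  rewrite -[RHS]comul_eta; symmetry.
  by refine (sw_map2 _ _ (bialg_mul_coalgebra_map hH) _); lin.
etransitivity; [refine (sw_antipoder (f := fun y => comul y) _ _ _); lin|].
by rewrite /= bialg_comul1.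
Qed.

End CocommutativeAntipode.

(** * The brace identity *)

Section Brace.
Variables (k : fieldType) (A H : coalgType k).
Variables (hA : hopf_algebra A) (hH : hopf_brace H).
Variables (rt : {linear (H ⊗ A)%type -> A}) (lt : {linear (H ⊗ A)%type -> H}).
Variable brt : {linear (H ⊗ A)%type -> A}.
Hypothesis cH : cocommutative H.
Hypothesis mp : matched_pair hA (dot hH) rt lt.
Hypothesis brtB : left_module_bialgebra (circ hH) hA brt.
Hypothesis brt_rt : forall (a : A) (x x' : H),
  brt (x ⊗ rt (x' ⊗ a))
  = \sw_(x1, x2, x3 <- x)
      rt (((x1 ·[circ hH] x') ·[dot hH] antipode (dot hH) x2) ⊗ brt (x3 ⊗ a)).
Hypothesis circ_lt : forall (a : A) (x x' : H),
  x ·[circ hH] lt (x' ⊗ a)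
  = \sw_(x1, x2, x3, x4 <- x)
      lt (((x1 ·[circ hH] x') ·[dot hH] antipode (dot hH) x2)
          ⊗ brt (x3 ⊗ a)) ·[dot hH] x4.

Local Notation D := (bicrossed_hopf mp).
Local Notation E := (smash_hopf cH brtB).
Local Notation S := (antipode (dot hH)).
Local Notation i a := (a ⊗ Defs.one (dot hH)).
Local Notation j x := (Defs.one hA ⊗ x).

Let brtD : coalgebra_map brt.
Proof. by case: brtB => -[]. Qed.
Let brtM x a b : brt (x ⊗ (a ·[hA] b)) =
  \sw_(x1, x2 <- x) brt (x1 ⊗ a) ·[hA] brt (x2 ⊗ b).
Proof. by case: brtB. Qed.
Let circD := bialg_mul_coalgebra_map (circ hH).
Let dotD := bialg_mul_coalgebra_map (dot hH).

Lemma bicrossed_dotE a x b y : (a ⊗ x) ·[D] (b ⊗ y) =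
  \sw_(x1, x2 <- x) \sw_(b1, b2 <- b)
    (a ·[hA] rt (x1 ⊗ b1)) ⊗ (lt (x2 ⊗ b2) ·[dot hH] y).
Proof. exact: bicrossed_mulE. Qed.

Lemma smash_circE a x b y : (a ⊗ x) ·[E] (b ⊗ y) =
  \sw_(x1, x2 <- x) (a ·[hA] brt (x1 ⊗ b)) ⊗ (x2 ·[circ hH] y).
Proof.
etransitivity; [exact: bicrossed_mulE|].
sw (rewrite trivial_rightE tensKZl tensZr; reflexivity).
sw (refine (sw_counitr (f := fun b => (_ ·[hA] brt (_ ⊗ b)) ⊗ _) _ _); lin).
reflexivity.
Qed.

(** Multiplying [circ_lt] by S of one further leg cancels its trailing factor; what remains has the
    same shape as [brt_rt]. *)
Lemma circ_lt_antipode x y c :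
  \sw_(x1, x2 <- x) (x1 ·[circ hH] lt (y ⊗ c)) ·[dot hH] S x2 =
  \sw_(x1, x2, x3 <- x) lt (((x1 ·[circ hH] y) ·[dot hH] S x2) ⊗ brt (x3 ⊗ c)).
Proof.
sw (rewrite circ_lt /sweedler4; prenex).
sweedler x.
sw (rewrite bialg_mulA; reflexivity).
sw (refine (sw_antipoder (f := fun h => _ ·[dot hH] h) _ _ _); lin).
sw (rewrite bialg_mul1r; reflexivity).
sw (refine (sw_counitr (f := fun h => lt (_ ⊗ brt (h ⊗ c))) _ _); lin).
reflexivity.
Qed.

Lemma bicrossed_mul_inlD a b y : i a ·[D] (b ⊗ y) = (a ·[hA] b) ⊗ y.
Proof. exact: bicrossed_mul_inl. Qed.

Lemma bicrossed_mul_inrD a x y : (a ⊗ x) ·[D] j y = a ⊗ (x ·[dot hH] y).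
Proof. exact: bicrossed_mul_inr. Qed.

Lemma bicrossed_antipodeD a x :
  antipode D (a ⊗ x) = j (S x) ·[D] i (antipode hA a).
Proof. exact: bicrossed_antipodeE. Qed.

Lemma brace_compat_right_tens b y c z x :
  j x ·[E] ((b ⊗ y) ·[D] (c ⊗ z)) =
  \sw_(x1, x2, x3 <- x)
    (j x1 ·[E] (b ⊗ y)) ·[D] j (S x2) ·[D] (j x3 ·[E] (c ⊗ z)).
Proof.
(* [brtM] splits the component in [A], the brace identity of [H] the one in [H]. The first two
   factors of the latter are grouped under [x3] to match [circ_lt_antipode]. *)
transitivity (\sw_(x1, x' <- x) \sw_(x2, x'' <- x') \sw_(x3, x8 <- x'')
  \sw_(y1, y2 <- y) \sw_(c1, c2 <- c)
    (brt (x1 ⊗ b) ·[hA] brt (x2 ⊗ rt (y1 ⊗ c1))) ⊗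
    ((\sw_(p, q <- x3) (p ·[circ hH] lt (y2 ⊗ c2)) ·[dot hH] S q)
      ·[dot hH] (x8 ·[circ hH] z))).
  rewrite bicrossed_dotE.
  sw prenex.
  sw (rewrite smash_circE; prenex).
  sw (rewrite bialg_mul1l brtM; prenex).
  sw (rewrite hopf_brace_compat /sweedler3; prenex).
  sweedler c.
  sweedler y.
  sweedler x.
  symmetry.
  sw prenex.
  sweedler c.
  sweedler y.
  sweedler x.
  reflexivity.
(* The two compatibility hypotheses replace [x2] by the legs [u1], [u2], [u3] and [x3] by [v1],
   [v2], [v3]. *)
transitivity (\sw_(x1, x' <- x) \sw_(x2, x'' <- x') \sw_(x3, x8 <- x'')
  \sw_(y1, y2 <- y) \sw_(c1, c2 <- c)
  \sw_(u1, u' <- x2) \sw_(u2, u3 <- u') \sw_(v1, v' <- x3) \sw_(v2, v3 <- v')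
    (brt (x1 ⊗ b) ·[hA]
       rt (((u1 ·[circ hH] y1) ·[dot hH] S u2) ⊗ brt (u3 ⊗ c1))) ⊗
    (lt (((v1 ·[circ hH] y2) ·[dot hH] S v2) ⊗ brt (v3 ⊗ c2))
      ·[dot hH] (x8 ·[circ hH] z))).
  do 5!(apply: eq_tsum => ? ?).
  by rewrite circ_lt_antipode brt_rt /sweedler3; prenex.
symmetry; rewrite /sweedler3.
sw (rewrite smash_circE; prenex).
sw (rewrite smash_circE; prenex).
sw (rewrite bicrossed_mul_inrD !bialg_mul1l bicrossed_dotE; prenex).
(* The coproduct of (x2 ∘ y) S(x3) is taken factor by factor, the last one by [comul_antipode]. *)
sw (refine (sw_map2 _ _ dotD _); lin).
sw (refine (sw_map2 _ _ circD _); lin).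
sw (refine (sw_map2 _ _ brtD _); lin).
sw (rewrite comul_antipode; [|exact: cH]; rewrite tsum_tsum; [|lin];
  sw (rewrite tsum_tens; [reflexivity|lin]); reflexivity).
sweedler c.
sweedler y.
sweedler x.
(* The legs of x are now distributed in the order 1, 2, 4, 6, 3, 5, 7, 8. *)
sw_exchange cH at 2.
sw_exchange cH at 4.
sw_exchange cH at 3.
symmetry.
sweedler c.
sweedler y.
sweedler x.
reflexivity.
Qed.

Lemma brace_compat_right u v x :
  j x ·[E] (u ·[D] v) =
  \sw_(x1, x2, x3 <- x) (j x1 ·[E] u) ·[D] j (S x2) ·[D] (j x3 ·[E] v).
Proof.
move: u; tens_ext => b y.
move: v; tens_ext => c z.
exact: brace_compat_right_tens.
Qed.

(** Left multiplication by [i a] is the same map for both products, so the factor from [A] can be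
    moved out of ∘. *)
Lemma smash_mul_inl a x v : (a ⊗ x) ·[E] v = i a ·[D] (j x ·[E] v).
Proof.
move: v; tens_ext => b y.
rewrite !smash_circE; symmetry.
by sw prenex; sw_intro; rewrite bicrossed_mul_inlD bialg_mul1l.
Qed.

Lemma brace_compat_bicrossed s u v :
  s ·[E] (u ·[D] v) =
  \sw_(s1, s2, s3 <- s) (s1 ·[E] u) ·[D] antipode D s2 ·[D] (s3 ·[E] v).
Proof.
move: s; tens_ext => a x.
rewrite smash_mul_inl brace_compat_right /sweedler3.
symmetry.
sw (refine (sw_tens _ _ _); lin).
sw (refine (sw_tens _ _ _); lin).
sw (rewrite smash_mul_inl [X in _ ·[D] X]smash_mul_inl bicrossed_antipodeD; reflexivity).
(* Reassociation brings i (S a2) next to i a3, so that the antipode of [A] cancels them. *)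
sw (rewrite !bialg_mulA -[i (antipode hA _) ·[D] _]bialg_mulA bicrossed_mul_inlD;
  reflexivity).
sweedler a.
sweedler x.
sw (refine (sw_antipodel
  (f := fun d => _ ·[D] (_ ·[D] (_ ·[D] ((d ⊗ _) ·[D] _)))) _ _ _); lin).
have oneD : i (Defs.one hA) = Defs.one D by [].
sw (rewrite oneD bialg_mul1l; reflexivity).
sw (refine (sw_counitr (f := fun a => i a ·[D] _) _ _); lin).
symmetry.
sw prenex.
sweedler x.
by sw_intro; rewrite !bialg_mulA.
Qed.

End Brace.

Theorem theorem2p5 (k : fieldType) (A H : coalgType k)
    (hA : hopf_algebra A) (hH : hopf_brace H)
    (rt : {linear (H ⊗ A)%type -> A}) (lt : {linear (H ⊗ A)%type -> H})
    (brt : {linear (H ⊗ A)%type -> A}) :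
  cocommutative H ->
  matched_pair hA (dot hH) rt lt ->
  left_module_bialgebra (circ hH) hA brt ->
  (forall (a : A) (x x' : H),
     brt (x ⊗ rt (x' ⊗ a))
     = \sw_(x1, x2, x3 <- x)
         rt (((x1 ·[circ hH] x') ·[dot hH] antipode (dot hH) x2)
             ⊗ brt (x3 ⊗ a))) ->
  (forall (a : A) (x x' : H),
     x ·[circ hH] lt (x' ⊗ a)
     = \sw_(x1, x2, x3, x4 <- x)
         lt (((x1 ·[circ hH] x') ·[dot hH] antipode (dot hH) x2)
             ⊗ brt (x3 ⊗ a)) ·[dot hH] x4) ->
  exists B : hopf_brace (A ⊗ H)%type,
    (forall (a b : A) (x y : H),
       (a ⊗ x) ·[dot B] (b ⊗ y)
       = \sw_(x1, x2 <- x) \sw_(b1, b2 <- b)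
           (a ·[hA] rt (x1 ⊗ b1)) ⊗ (lt (x2 ⊗ b2) ·[dot hH] y)) /\
    (forall (a b : A) (x y : H),
       (a ⊗ x) ·[circ B] (b ⊗ y)
       = \sw_(x1, x2 <- x)
           (a ·[hA] brt (x1 ⊗ b)) ⊗ (x2 ·[circ hH] y)).
Proof.
move=> cH mp brtB brt_rt circ_lt.
exists (HopfBrace (brace_compat_bicrossed cH mp brtB brt_rt circ_lt)).
by split=> a b x y; [exact: bicrossed_dotE|exact: smash_circE].
Qed.
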